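(* Let $S=\{n_1,\dots,n_r\}$ be a set of pairwise coprime positive integers such that $n_i\ge 2$ for some $i$. Let $$\Gamma(S)=\langle a,t_1,\dots,t_r \mid t_it_j=t_jt_i\ (i\neq j),\ t_iat_i^{-1}=a^{n_i}\ (i=1,\dots,r)\rangle .$$ For $1\le i\le r$ let $\chi_i:\Gamma(S)\to\mathbb{R}$ be the homomorphism with $\chi_i(t_i)=1$ and $\chi_i(t_j)=0$ for $j\ne i$ (necessarily $\chi_i(a)=0$). Then the complement of $\Sigma^1(\Gamma(S))$ in $S(\Gamma(S))$ is $$\Sigma^1(\Gamma(S))^c=\{[\chi_i]\mid 1\le i\le r\}.$$ In particular, if $n\ge 2$ has prime decomposition $n=p_1^{y_1}\cdots p_r^{y_r}$ (the $p_i$ pairwise distinct primes, $y_i\ge 1$) and $\Gamma_n=\Gamma(\{p_1^{y_1},\dots,p_r^{y_r}\})$, with $n_i=p_i^{y_i}$, then $\Sigma^1(\Gamma_n)^c=\{[\chi_1],\dots,[\chi_r]\}$. Furthermore, $\Sigma^1(\Gamma(S))^c$ lies inside an open hemisphere of $S(\Gamma(S))$.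
   Context: For a finitely generated group $G$, the character sphere is $S(G)=(\mathrm{Hom}(G,\mathbb{R})\setminus\{0\})/\sim$, where $\chi\sim\chi'$ iff $r\chi=\chi'$ for some real $r>0$; $[\chi]$ denotes the class of $\chi$. If $G^{ab}$ has free rank $N$ and $x_1,\dots,x_N\in G$ map to a basis of $G^{ab}$ modulo torsion, then $S(G)$ is identified with $S^{N-1}$ via $[\chi]\mapsto (\chi(x_1),\dots,\chi(x_N))/\|(\chi(x_1),\dots,\chi(x_N))\|$. An open hemisphere of $S(G)$ is a subset corresponding to $\{x\in S^{N-1}\mid\langle x,v\rangle>0\}$ for some $v\in S^{N-1}$. For $\Gamma(S)$ the elements $x_i=t_i$ ($1\le i\le r$) are used. Let $X$ be a finite generating set of $G$ and $\Gamma(G,X)$ the Cayley graph whose vertices are the elements of $G$, with edges joining $g$ and $gy$ for $g\in G$, $y\in X\cup X^{-1}$. For $\chi\in\mathrm{Hom}(G,\mathbb{R})\setminus\{0\}$, let $\Gamma_\chi$ be the full subgraph of $\Gamma(G,X)$ on the vertices $g$ with $\chi(g)\ge 0$. The Bieri-Neumann-Strebel invariant is $\Sigma^1(G)=\{[\chi]\in S(G)\mid \Gamma_\chi \text{ is connected}\}$ (independent of $X$).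
   Formalization: The equality with {[χ_i] | 1≤i≤r} fails if some n_i=1 (then t_i is central, so [χ_i]∈Σ^1; e.g. S={1,2}); what is proved is Σ^1(Γ(S))^c={[χ_i] | n_i≥2} for every S, hence the stated equality when all n_i≥2. *)

(* Defs.v *)
From HB Require Import structures.
From mathcomp Require Import all_boot all_order all_algebra.
From mathcomp Require Import all_classical reals.

Set Implicit Arguments.
Unset Strict Implicit.
Unset Printing Implicit Defensive.

Import Order.TTheory GRing.Theory Num.Theory.
Local Open Scope classical_set_scope.
Local Open Scope ring_scope.
Local Open Scope quotient_scope.

(* The letter (x, false) stands for x and (x, true) for x^-1. *)
Definition word (T : Type) := seq (T * bool).

Definition winv (T : Type) (w : word T) : word T :=
  rev [seq (l.1, ~~ l.2) | l <- w].

(* E u v is a defining relation u = v.  [pres_eq E] is the least congruence on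
   words that contains E and the free cancellations; the group presented by E
   is the quotient of the words by it. *)
Inductive pres_eq (T : Type) (E : word T -> word T -> Prop) :
    word T -> word T -> Prop :=
  | pres_refl u : pres_eq E u u
  | pres_sym u v : pres_eq E u v -> pres_eq E v u
  | pres_trans u v w : pres_eq E u v -> pres_eq E v w -> pres_eq E u w
  | pres_cat u u' v v' :
      pres_eq E u u' -> pres_eq E v v' -> pres_eq E (u ++ v) (u' ++ v')
  | pres_cancel x b : pres_eq E [:: (x, b); (x, ~~ b)] [::]
  | pres_rel u v : E u v -> pres_eq E u v.

Section Presented.
Variables (T : choiceType) (E : word T -> word T -> Prop).

Definition pres_eqb : rel (word T) := fun u v => `[< pres_eq E u v >].

Lemma pres_eqb_refl : reflexive pres_eqb.
Proof. by move=> u; apply/asboolP/pres_refl. Qed.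

Lemma pres_eqb_sym : symmetric pres_eqb.
Proof. by move=> u v; apply/asboolP/asboolP => /pres_sym. Qed.

Lemma pres_eqb_trans : transitive pres_eqb.
Proof.
by move=> v u w /asboolP uv /asboolP vw; apply/asboolP/(pres_trans uv vw).
Qed.

Canonical pres_equiv := EquivRel pres_eqb pres_eqb_refl pres_eqb_sym
  pres_eqb_trans.

Definition presented := {eq_quot pres_equiv}.
HB.instance Definition _ := Choice.on presented.
HB.instance Definition _ := EqQuotient.on presented.

Definition pclass (w : word T) : presented := \pi_presented w.

Lemma pclassP u v : pclass u = pclass v <-> pres_eq E u v.
Proof. by split=> [/eqmodP /asboolP|/asboolP uv]; last exact/eqmodP. Qed.

Lemma pclass_repr (g : presented) : pclass (repr g) = g.
Proof. exact: reprK. Qed.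

Lemma pres_repr w : pres_eq E (repr (pclass w)) w.
Proof. by apply/pclassP; rewrite pclass_repr. Qed.

Definition pmul (g h : presented) : presented := pclass (repr g ++ repr h).
Definition pinv (g : presented) : presented := pclass (winv (repr g)).
Definition pone : presented := pclass [::].

Lemma winv_cat (u v : word T) : winv (u ++ v) = winv v ++ winv u.
Proof. by rewrite /winv map_cat rev_cat. Qed.

Lemma winvK : involutive (@winv T).
Proof.
move=> w; rewrite /winv -map_rev revK -map_comp map_id_in// => -[x b] _ /=.
by rewrite negbK.
Qed.

Lemma pres_mulV w : pres_eq E (w ++ winv w) [::].
Proof.
elim: w => [|[x b] w IH]; first exact: pres_refl.
rewrite -cat1s winv_cat -catA (catA w).
apply: (@pres_trans _ _ _ ([:: (x, b)] ++ ([::] ++ winv [:: (x, b)]))).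
  by do 2?apply: pres_cat => //; apply: pres_refl.
exact: pres_cancel.
Qed.

Lemma pres_Vmul w : pres_eq E (winv w ++ w) [::].
Proof. by rewrite -{2}(winvK w); exact: pres_mulV. Qed.

Lemma pres_winv u v : pres_eq E u v -> pres_eq E (winv u) (winv v).
Proof.
move=> uv.
apply: (@pres_trans _ _ _ (winv u ++ (v ++ winv v))).
  rewrite -{1}(cats0 (winv u)); apply: pres_cat; first exact: pres_refl.
  exact/pres_sym/pres_mulV.
rewrite catA -{2}(cat0s (winv v)); apply: pres_cat; last exact: pres_refl.
apply: (@pres_trans _ _ _ (winv u ++ u)); last exact: pres_Vmul.
by apply: pres_cat; [exact: pres_refl|exact: pres_sym].
Qed.

Lemma pclassM u v : pmul (pclass u) (pclass v) = pclass (u ++ v).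
Proof. by apply/pclassP/pres_cat; exact: pres_repr. Qed.

Lemma pclassV u : pinv (pclass u) = pclass (winv u).
Proof. by apply/pclassP/pres_winv/pres_repr. Qed.

Lemma pmulA : associative pmul.
Proof.
move=> x y z; rewrite -(pclass_repr x) -(pclass_repr y) -(pclass_repr z).
by rewrite !pclassM catA.
Qed.

Lemma pmul1g : left_id pone pmul.
Proof. by move=> x; rewrite -(pclass_repr x) pclassM. Qed.

Lemma pmulg1 : right_id pone pmul.
Proof. by move=> x; rewrite -(pclass_repr x) pclassM cats0. Qed.

Lemma pmulVg : left_inverse pone pinv pmul.
Proof.
move=> x; rewrite -(pclass_repr x) pclassV pclassM.
exact/pclassP/pres_Vmul.
Qed.

Lemma pmulgV : right_inverse pone pinv pmul.
Proof.
move=> x; rewrite -(pclass_repr x) pclassV pclassM.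
exact/pclassP/pres_mulV.
Qed.

HB.instance Definition _ :=
  isGroup.Build presented pmulA pmul1g pmulg1 pmulVg pmulgV.

Definition pgen (x : T) : presented := pclass [:: (x, false)].

End Presented.

(* Γ({n_1, ..., n_r}): the letter None is a, and Some i is t_i. *)
Inductive gamma_rel (r : nat) (n : 'I_r -> nat) :
    word (option 'I_r) -> word (option 'I_r) -> Prop :=
  | gamma_comm i j : i != j ->
      gamma_rel n [:: (Some i, false); (Some j, false)]
                  [:: (Some j, false); (Some i, false)]
  | gamma_conj i :
      gamma_rel n [:: (Some i, false); (None, false); (Some i, true)]
                  (nseq (n i) (None, false)).

Definition gamma (r : nat) (n : 'I_r -> nat) := presented (gamma_rel n).
HB.instance Definition _ (r : nat) (n : 'I_r -> nat) := Group.on (gamma n).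

Definition gamma_a (r : nat) (n : 'I_r -> nat) : gamma n :=
  pgen (gamma_rel n) None.
Definition gamma_t (r : nat) (n : 'I_r -> nat) (i : 'I_r) : gamma n :=
  pgen (gamma_rel n) (Some i).

Definition generates (G : groupType) (X : set G) : Prop :=
  forall H : {pred G}, group_closed H -> X `<=` [set` H] -> H =i predT.

Record nzchar (R : realType) (G : groupType) := NzChar {
  nzchar_fun :> G -> R;
  nzcharM : forall g h, nzchar_fun (g * h)%g = nzchar_fun g + nzchar_fun h;
  nzchar_neq0 : exists g, nzchar_fun g != 0 }.

HB.instance Definition _ (R : realType) (G : groupType) :=
  gen_eqMixin (nzchar R G).
HB.instance Definition _ (R : realType) (G : groupType) :=
  gen_choiceMixin (nzchar R G).

Section CharSphere.
Variables (R : realType) (G : groupType).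

Definition char_ray : rel (nzchar R G) := fun chi chi' =>
  `[< exists2 r : R, 0 < r & forall g, r * chi g = chi' g >].

Lemma char_ray_refl : reflexive char_ray.
Proof. by move=> chi; apply/asboolP; exists 1 => // g; rewrite mul1r. Qed.

Lemma char_ray_sym : symmetric char_ray.
Proof.
move=> chi chi'; apply/asboolP/asboolP => -[r r0 e]; exists r^-1;
  rewrite ?invr_gt0// => g; by rewrite -e mulKf ?gt_eqF.
Qed.

Lemma char_ray_trans : transitive char_ray.
Proof.
move=> psi chi phi /asboolP[r r0 er] /asboolP[s s0 es]; apply/asboolP.
by exists (s * r) => [|g]; rewrite ?mulr_gt0// -es -er mulrA.
Qed.

Canonical char_ray_equiv := EquivRel char_ray char_ray_refl char_ray_sym
  char_ray_trans.

Definition char_sphere := {eq_quot char_ray_equiv}.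
HB.instance Definition _ := Choice.on char_sphere.
HB.instance Definition _ := EqQuotient.on char_sphere.

Definition char_class (chi : nzchar R G) : char_sphere := \pi_char_sphere chi.

Lemma char_classP chi chi' : char_class chi = char_class chi' <->
  exists2 r : R, 0 < r & forall g, r * chi g = chi' g.
Proof. by split=> [/eqmodP /asboolP|/asboolP cc']; last exact/eqmodP. Qed.

Definition cayley_edge (X : set G) (g h : G) : Prop :=
  exists2 y, X y \/ X y^-1%g & h = (g * y)%g.

Definition cayley_edge_ge0 (X : set G) (chi : nzchar R G) : rel G :=
  fun g h => [&& 0 <= chi g, 0 <= chi h & `[< cayley_edge X g h >]].

Definition cayley_ge0_connected (X : set G) (chi : nzchar R G) : Prop :=
  forall g h, 0 <= chi g -> 0 <= chi h ->
    exists2 p : seq G, path (cayley_edge_ge0 X chi) g p & last g p = h.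

(* Σ^1(G) does not depend on X when X is a finite generating set. *)
Definition Sigma1 (X : set G) : set char_sphere :=
  char_class @` [set chi | cayley_ge0_connected X chi].

End CharSphere.

(* The library's norm on 'rV[R]_N is the max norm. *)
Definition dotrv (R : realType) (N : nat) (u v : 'rV[R]_N) : R :=
  \sum_i u 0 i * v 0 i.
Definition enorm (R : realType) (N : nat) (v : 'rV[R]_N) : R :=
  Num.sqrt (dotrv v v).

Section Hemisphere.
Variables (R : realType) (G : groupType) (N : nat) (x : 'I_N -> G).

Definition char_coord (chi : nzchar R G) : 'rV[R]_N :=
  (enorm (\row_i chi (x i)))^-1 *: \row_i chi (x i).

Definition sphere_coord (c : char_sphere R G) : 'rV[R]_N :=
  char_coord (repr c).

Definition open_hemisphere (H : set (char_sphere R G)) : Prop :=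
  exists2 v : 'rV[R]_N, enorm v = 1 & H = [set c | 0 < dotrv (sphere_coord c) v].

Lemma sphere_coord_class chi : sphere_coord (char_class chi) = char_coord chi.
Proof.
have [r r0 e] : exists2 r : R, 0 < r &
    forall g, r * chi g = repr (char_class chi) g.
  by apply/char_classP; rewrite /char_class reprK.
rewrite /sphere_coord /char_coord.
have -> : \row_i repr (char_class chi) (x i) = r *: \row_i chi (x i).
  by apply/rowP => i; rewrite !mxE -e.
set u := \row_i chi (x i); have -> : enorm (r *: u) = r * enorm u.
  rewrite /enorm; have -> : dotrv (r *: u) (r *: u) = r ^+ 2 * dotrv u u.
    rewrite /dotrv mulr_sumr; apply: eq_bigr => i _.
    by rewrite !mxE mulrACA expr2.
  by rewrite sqrtrM ?sqr_ge0// sqrtr_sqr gtr0_norm.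
by rewrite scalerA invfM mulrAC mulVf ?gt_eqF// mul1r.
Qed.

End Hemisphere.

Section GammaChar.
Variables (R : realType) (r : nat) (n : 'I_r -> nat).

(* Exponent sum of t_i in a word; it induces the character χ_i ([tchar i]). *)
Definition texp (i : 'I_r) (w : word (option 'I_r)) : R :=
  \sum_(l <- w | l.1 == Some i) (if l.2 then -1 else 1).

Lemma texp_cat i u v : texp i (u ++ v) = texp i u + texp i v.
Proof. exact: big_cat. Qed.

Lemma texp_pres i u v : pres_eq (gamma_rel n) u v -> texp i u = texp i v.
Proof.
elim=> {u v} //.
- by move=> u v w _ -> _ ->.
- by move=> u u' v v' _ eu _ ev; rewrite !texp_cat eu ev.
- move=> x b; rewrite /texp !big_cons big_nil /=.
  case: (x == Some i) => //.
  by case: b; rewrite /= addr0 ?subrr ?addNr.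
move=> u v [j k _|j]; rewrite /texp.
  rewrite !big_cons big_nil /=.
  by case: (Some j == Some i); case: (Some k == Some i).
rewrite !big_cons big_nil /= big1_seq.
  by case: (Some j == Some i); rewrite ?addr0 ?subrr.
by move=> l /andP[/eqP li /nseqP[le _]]; rewrite le in li.
Qed.

Definition tchar_fun (i : 'I_r) (g : gamma n) : R := texp i (repr g).

Lemma tchar_class i w : tchar_fun i (pclass (gamma_rel n) w) = texp i w.
Proof. exact/texp_pres/pres_repr. Qed.

Lemma tchar_funM i g h :
  tchar_fun i (g * h)%g = tchar_fun i g + tchar_fun i h.
Proof. by rewrite -texp_cat -tchar_class. Qed.

Lemma tchar_fun_t i j : tchar_fun i (gamma_t n j) = (j == i)%:R.
Proof.
by rewrite tchar_class /texp big_cons big_nil /= -[Some j == _]/(j == i);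
  case: eqP => _; rewrite ?addr0.
Qed.

Lemma tchar_neq0 i : exists g, tchar_fun i g != 0.
Proof. by exists (gamma_t n i); rewrite tchar_fun_t eqxx oner_neq0. Qed.

Definition tchar (i : 'I_r) : nzchar R (gamma n) :=
  NzChar (tchar_funM i) (tchar_neq0 i).

Lemma tchar_t i j : tchar i (gamma_t n j) = (j == i)%:R.
Proof. exact: tchar_fun_t. Qed.

Lemma tchar_a i : tchar i (gamma_a n) = 0.
Proof. by rewrite /= tchar_class /texp big_cons big_nil. Qed.

End GammaChar.

Section GammaFacts.
Variables (r : nat) (n : 'I_r -> nat).

Lemma gamma_tC i j : (gamma_t n i * gamma_t n j = gamma_t n j * gamma_t n i)%g.
Proof.
have [->//|ij] := eqVneq i j.
rewrite [LHS]pclassM [RHS]pclassM; apply/pclassP/pres_rel.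
exact: gamma_comm.
Qed.

Lemma gamma_ta i :
  (gamma_t n i * gamma_a n * (gamma_t n i)^-1 = gamma_a n ^+ n i)%g.
Proof.
have -> : (gamma_a n ^+ n i)%g = pclass (gamma_rel n) (nseq (n i) (None, false)).
  elim: (n i) => [//|k IH].
  by rewrite expgS IH [LHS]pclassM.
rewrite [(gamma_t n i * _)%g]pclassM [_^-1%g]pclassV [LHS]pclassM.
exact/pclassP/pres_rel/gamma_conj.
Qed.

Lemma gamma_generates :
  generates [set g | g = gamma_a n \/ exists i, g = gamma_t n i].
Proof.
move=> H Hc HX g; rewrite inE.
have [H1 HF] := Hc.
have HV h : h \in H -> h^-1%g \in H by move=> hH; rewrite -div1g; exact: HF.
have HM h k : h \in H -> k \in H -> (h * k)%g \in H.
  by move=> hH kH; rewrite -(invgK k); apply: HF => //; exact: HV.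
rewrite -(pclass_repr g); elim: (repr g) => [|[x b] w IH]; first exact: H1.
rewrite -cat1s -pclassM; apply: (HM _ _ _ IH).
have xH : pgen (gamma_rel n) x \in H.
  by case: x => [i|]; apply: HX; [right; exists i|left].
by case: b => //; rewrite -[[:: _]]/(winv [:: (x, false)]) -pclassV; exact: HV.
Qed.

(* Since some n_j >= 2, characters vanish on a, so they are determined by their
   values on the t_i; in particular tchar i is the only character that takes the
   values of χ_i on the t_j. *)
Lemma char_gamma_a (R : realType) (chi : nzchar R (gamma n)) j :
  (1 < n j)%N -> chi (gamma_a n) = 0.
Proof.
move=> nj; have chi1 : chi 1%g = 0.
  by apply: (@addrI _ (chi 1%g)); rewrite -nzcharM mulg1 addr0.
have chiX k : chi (gamma_a n ^+ k)%g = chi (gamma_a n) *+ k.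
  by elim: k => [|k IH]; rewrite ?expg0// expgS nzcharM IH mulrS.
have := congr1 chi (gamma_ta j); rewrite !nzcharM chiX => /eqP.
have -> : chi (gamma_t n j)^-1%g = - chi (gamma_t n j).
  by apply/eqP; rewrite -addr_eq0 -nzcharM mulVg chi1.
rewrite addrAC subrr add0r -subr_eq0 -{1}[chi (gamma_a n)]mulr1n.
rewrite -opprB -mulrnBr; last exact: ltnW.
by rewrite oppr_eq0 mulrn_eq0 subn_eq0 leqNgt nj => /eqP.
Qed.

Lemma char_gamma_ext (R : realType) (chi psi : nzchar R (gamma n)) j :
  (1 < n j)%N -> (forall i, chi (gamma_t n i) = psi (gamma_t n i)) ->
  chi =1 psi.
Proof.
move=> nj e g; apply/eqP.
have H1 (phi : nzchar R (gamma n)) : phi 1%g = 0.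
  by apply: (@addrI _ (phi 1%g)); rewrite -nzcharM mulg1 addr0.
have HV (phi : nzchar R (gamma n)) h : phi h^-1%g = - phi h.
  by apply/eqP; rewrite -addr_eq0 -nzcharM mulVg H1.
have : g \in [pred g | chi g == psi g]; last by [].
rewrite gamma_generates//=.
  split=> [|x y /eqP ex /eqP ey]; first by rewrite inE !H1.
  by rewrite inE !nzcharM !HV ex ey.
by move=> h [->|[i ->]] /=; rewrite inE ?e// !(char_gamma_a _ nj).
Qed.

End GammaFacts.

(* Main.v *)
Require Import Defs.
From mathcomp Require Import all_boot all_order all_algebra.
From mathcomp Require Import all_classical reals.
From mathcomp Require Import ring lra.

Set Implicit Arguments.
Unset Strict Implicit.
Unset Printing Implicit Defensive.

Import Order.TTheory GRing.Theory Num.Theory.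
Local Open Scope classical_set_scope.
Local Open Scope ring_scope.

(** Write [a], [t i] for the generators, A for the normal closure of [a], and C
    for the set of elements with nonnegative character that can be reached from
    1 inside the half-space Γ_χ.

    Connectedness.  The group is abelian by abelian: the quotient by A is
    generated by the commuting [t i], and A is abelian because any two
    conjugates of [a] become powers of [a] after conjugation by a suitable
    product of the [t i].  On A, conjugation by [t i] is g |-> g ^+ n i.  If
    χ(u) > 0 and χ(g) >= 0, a path for g can be read at the height reached by a
    large power of u, so if u is itself in C then u^M g u^-M is in C for some M
    ([reachable_conj]).  Two consequences carry the argument: Γ_χ is connected
    as soon as A is contained in C ([connected_of_kernel]), and for every g in A
    and every u with χ(u) > 0 some u^M g u^-M is in C ([reachable_contract]).
    Since the elements of C of character 0 form a group, A is contained in C in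
    each of the following cases.
    - χ(t j) < 0 for some j: with u = (t j)^-1 an (n j)^M-th root of g is in C,
      hence so is g ([connected_neg]).
    - χ(t j) and χ(t k) are positive, j <> k: g^(n j ^ M) and g^(n k ^ K) are in
      C, hence so is g by a Bezout relation ([connected_coprime]).
    - χ(t j) > 0 and n j = 1: g is fixed by t j ([connected_trivial]).
    As χ vanishes on [a], only the positive multiples of the χ_j with n j > 1
    remain ([disconnected_axis]).

    Disconnectedness.  The group acts on the rationals by [a] : z |-> z + 1 and
    [t i] : z |-> n i * z.  Let p be a prime divisor of n j.  The slope of g is
    n j to the power χ_j(g), times a factor integral at p.  So along a path from
    1 inside Γ_(χ_j) all slopes are integral at p, and the image of 0 has at most
    the p-denominators of the finitely many generators ([reach_pint]).  But
    t_j^-k a t_j^k lies in the half-space and moves 0 to n j ^- k, for every k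
    ([axis_disconnected]).

    The χ_i correspond to the coordinate vectors of the sphere, which all lie in
    the open hemisphere centred at the diagonal ([axes_in_hemisphere]). *)

(** * Characters *)

(** Generation quantifies over boolean subgroups; classically this gives an
    induction principle for propositions. *)
Lemma generates_ind (G : groupType) (X : set G) (P : G -> Prop) :
  generates X -> P 1%g -> (forall g h, P g -> P h -> P (g * h^-1)%g) ->
  (forall x, X x -> P x) -> forall g, P g.
Proof.
move=> genX P1 PV PX g; apply/asboolP.
have : g \in [pred h | `[< P h >]]; last by [].
rewrite genX //; first split; first exact/asboolP.
  by move=> x y /asboolP Px /asboolP Py; apply/asboolP/PV.
by move=> x Xx; apply/asboolP/PX.
Qed.

Section Characters.
Variables (R : realType) (G : groupType).
Implicit Types (chi psi : nzchar R G) (g h : G).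

Lemma nzchar1 chi : chi 1%g = 0.
Proof. by apply: (@addrI _ (chi 1%g)); rewrite -nzcharM mulg1 addr0. Qed.

Lemma nzcharV chi g : chi g^-1%g = - chi g.
Proof. by apply/eqP; rewrite -addr_eq0 -nzcharM mulVg nzchar1. Qed.

Lemma nzcharX chi g k : chi (g ^+ k)%g = chi g *+ k.
Proof.
by elim: k => [|k IH]; rewrite ?expg0 ?nzchar1// expgS nzcharM IH mulrS.
Qed.

Lemma nzcharJ chi g h : chi (g ^ h)%g = chi g.
Proof. by rewrite !nzcharM nzcharV addrC addrK. Qed.

End Characters.

(** * Reachability inside the half-space of a character *)

Section Reachability.
Variables (R : realType) (G : groupType) (X : set G) (chi : nzchar R G).
Hypothesis genX : generates X.

Definition reach (g h : G) : Prop :=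
  exists2 p : seq G, path (cayley_edge_ge0 X chi) g p & last g p = h.

Lemma reach_refl g : reach g g.
Proof. by exists [::]. Qed.

Lemma reach_trans h g k : reach g h -> reach h k -> reach g k.
Proof.
move=> [p pp <-] [q qq <-]; exists (p ++ q); last by rewrite last_cat.
by rewrite cat_path pp.
Qed.

Lemma cayley_edge_sym g h : cayley_edge X g h -> cayley_edge X h g.
Proof.
move=> [y Xy ->]; exists y^-1%g; last by rewrite mulgK.
by rewrite invgK; case: Xy; [right|left].
Qed.

Lemma reach_step g h :
  cayley_edge X g h -> 0 <= chi g -> 0 <= chi h -> reach g h.
Proof.
by move=> e g0 h0; exists [:: h] => //=; rewrite andbT /cayley_edge_ge0 g0 h0/=;
  exact/asboolP.
Qed.

Lemma reach_sym g h : reach g h -> reach h g.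
Proof.
move=> [p]; elim: p g => [|k p IH] g /=; first by move=> _ ->; exact: reach_refl.
move=> /andP[/and3P[g0 k0 /asboolP e] pp] /(IH _ pp) hk.
by apply: (reach_trans hk); apply: reach_step => //; exact: cayley_edge_sym.
Qed.

(** Left translations are automorphisms of the Cayley graph, and those of
    nonnegative character preserve the half-space. *)
Lemma reach_translate k g h : 0 <= chi k -> reach g h -> reach (k * g)%g (k * h)%g.
Proof.
move=> k0 [p]; elim: p g => [|l p IH] g /=; first by move=> _ ->; exact: reach_refl.
move=> /andP[/and3P[g0 l0 /asboolP[y Xy e]] pp] /(IH _ pp); apply: reach_trans.
by apply: reach_step; rewrite ?nzcharM ?addr_ge0//; exists y => //; rewrite e mulgA.
Qed.

(** A word representing [g] dips below its starting point by a bounded amount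
    only, so it can be read from every vertex that is high enough. *)
Lemma reach_high g :
  exists2 c, 0 <= c & forall h, c <= chi h -> reach h (h * g)%g.
Proof.
pattern g; apply: (generates_ind genX) => {g}.
- by exists 0 => // h _; rewrite mulg1; exact: reach_refl.
- move=> g k [c c0 cP] [d d0 dP].
  have dV h : d + `|chi k| <= chi h -> reach h (h * k^-1)%g.
    move=> hd; apply: reach_sym; rewrite -{2}[h](mulgVK k); apply: dP.
    by rewrite nzcharM nzcharV; have := ler_norm (chi k); lra.
  (* After reading [g] the height is still at least [d + |chi k|]. *)
  exists (c + d + `|chi k| + `|chi g|); first by rewrite !addr_ge0.
  move=> h hc; apply: (@reach_trans (h * g)%g).
    by apply: cP; have := normr_ge0 (chi g); have := normr_ge0 (chi k); lra.
  rewrite mulgA; apply: dV; rewrite nzcharM.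
  by have := ler_norm (- chi g); rewrite normrN; lra.
- move=> x Xx; exists `|chi x| => // h hx.
  apply: reach_step; first by exists x => //; left.
    exact: le_trans hx.
  by rewrite nzcharM; have := ler_norm (- chi x); rewrite normrN; lra.
Qed.

(** This set is closed under products, and under inverses of elements of
    character 0. *)
Definition reachable g := 0 <= chi g /\ reach 1%g g.

Lemma reachable_connected :
  (forall g, 0 <= chi g -> reachable g) -> cayley_ge0_connected X chi.
Proof.
move=> H g h /H[_ g1] /H[_ h1].
exact: reach_trans (reach_sym g1) h1.
Qed.

Lemma reachableM g h : reachable g -> reachable h -> reachable (g * h)%g.
Proof.
move=> [g0 g1] [h0 h1]; split; first by rewrite nzcharM addr_ge0.
by apply: (reach_trans g1); rewrite -{1}[g]mulg1; exact: reach_translate.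
Qed.

Lemma reachable1 : reachable 1%g.
Proof. by split; [rewrite nzchar1|exact: reach_refl]. Qed.

Lemma reachableX g k : reachable g -> reachable (g ^+ k)%g.
Proof.
move=> gr; elim: k => [|k IH]; first exact: reachable1.
by rewrite expgS; exact: reachableM.
Qed.

Lemma reachableV g : chi g = 0 -> reachable g -> reachable g^-1%g.
Proof.
move=> g0 [_ g1]; split; first by rewrite nzcharV g0 oppr0.
apply: reach_sym; rewrite -[X in reach _ X](mulVg g) -{1}[(g^-1)%g]mulg1.
by apply: reach_translate; rewrite ?nzcharV ?g0 ?oppr0.
Qed.

(** Otherwise the character would vanish on the generators. *)
Lemma reachable_positive : exists2 s, reachable s & 0 < chi s.
Proof.
apply: contrapT => Hn; have [g] := nzchar_neq0 chi; apply/negP; rewrite negbK.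
have X0 x : X x -> chi x = 0.
  move=> Xx; have posP y : X y \/ X (y^-1)%g -> 0 < chi y -> False.
    move=> Xy y0; apply: Hn; exists y => //; split; first exact: ltW.
    apply: reach_step; rewrite ?nzchar1//; last exact: ltW.
    by exists y => //; rewrite mul1g.
  have [x0|x0|//] := ltgtP (chi x) 0.
    case: (posP (x^-1)%g); first by rewrite invgK; right.
    by rewrite nzcharV oppr_gt0.
  by case: (posP x) => //; left.
apply/eqP; pattern g; apply: (generates_ind genX); first exact: nzchar1.
  by move=> h k; rewrite nzcharM nzcharV => -> ->; rewrite subr0.
by [].
Qed.

(** The path climbs along [u ^+ M], reads [g] at that height, and comes down
    along a left translate of the first part. *)
Lemma reachable_conj u g : reachable u -> 0 < chi u -> 0 <= chi g ->
  exists M, reachable (g ^ (u ^- M))%g.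
Proof.
move=> ur u0 g0; have [c c0 cP] := reach_high g.
pose M := Num.bound (c / chi u); exists M.
have hM : c <= chi (u ^+ M)%g.
  rewrite nzcharX -mulr_natl -ler_pdivrMr// ltW// archi_boundP//.
  by rewrite divr_ge0// ltW.
split; first by rewrite nzcharJ.
have [_ uM] := reachableX M ur.
apply: (reach_trans uM); apply: (reach_trans (cP _ hM)); apply: reach_sym.
rewrite -[X in reach X _]mulg1 /conjg invgK.
rewrite -[X in reach _ X](mulgVK (u ^+ M)%g) -(mulgA _ g).
by apply: reach_translate; rewrite // !nzcharM nzcharV addrCA subrr addr0.
Qed.

Section AbelianByAbelian.
Variable A : G -> Prop.
Hypothesis A_comm : forall g h, A [~ g, h]%g.
Hypothesis A_abel : forall g h, A g -> A h -> commute g h.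
Hypothesis A_char : forall g, A g -> chi g = 0.

(** Some conjugate of [g] is reachable by [reachable_conj], and it differs from
    [g] by a commutator, that is, by a reachable element. *)
Lemma connected_of_kernel :
  (forall g, A g -> reachable g) -> cayley_ge0_connected X chi.
Proof.
move=> AC; apply: reachable_connected => g g0.
have [s sr s0] := reachable_positive.
have [M gM] := reachable_conj sr s0 g0.
rewrite (_ : g = (g ^ (s ^- M) * [~ s ^- M, g])%g).
  by apply: reachableM => //; exact/AC/A_comm.
by rewrite commgEr mulgA -conjMg mulgV conj1g mul1g.
Qed.

(** Some conjugate [v] of [u] is reachable; as [v] and [u] agree modulo [A] and
    [A] is abelian, they act in the same way on [A]. *)
Lemma reachable_contract u g : A g -> 0 < chi u ->
  exists M, reachable (g ^ (u ^- M))%g.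
Proof.
move=> Ag u0; have [s sr s0] := reachable_positive.
have [K vr] := reachable_conj sr s0 (ltW u0).
have [||M] := reachable_conj (g := g) vr; rewrite ?nzcharJ ?(A_char Ag)//.
rewrite -conjXg -conjVg => gM; exists M.
have -> // : (g ^ (u ^- M) = g ^ ((u ^- M) ^ (s ^- K)))%g.
set w := (u ^- M)%g; set z := (s ^- K)%g.
have -> : (w ^ z = [~ z, w^-1] * w)%g by rewrite commgEr invgK mulgVK.
rewrite conjgM; congr (_ ^ _)%g; apply/esym/eqP; rewrite conjg_fix.
exact/commgP/A_abel.
Qed.

End AbelianByAbelian.
End Reachability.

(** * The normal closure of the generator a *)

Section Kernel.
Variables (r : nat) (n : 'I_r -> nat).
Local Notation a := (gamma_a n).
Local Notation t := (gamma_t n).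
Local Open Scope group_scope.

Inductive tmonoid : gamma n -> Prop :=
  | tmonoid1 : tmonoid 1
  | tmonoidM i s : tmonoid s -> tmonoid (t i * s).

(** The normal closure of [a].  Conjugates by the [s] in [tmonoid] suffice, since
    conjugation by [(t i)^-1] only takes powers; this form makes commutativity
    and the action of the [t i] easy to check on generators. *)
Inductive akernel : gamma n -> Prop :=
  | akernel_gen s : tmonoid s -> akernel (a ^ s)
  | akernel_div g h : akernel g -> akernel h -> akernel (g * h^-1).

Lemma gamma_aJ i : a ^ (t i)^-1 = a ^+ n i.
Proof. by rewrite -gamma_ta /conjg invgK mulgA. Qed.

Lemma tmonoid_commute_t s i : tmonoid s -> commute (t i) s.
Proof.
elim=> [|j u _ IH]; first exact: commute1.
by apply: commuteM IH; exact: gamma_tC.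
Qed.

Lemma tmonoid_commute s u : tmonoid s -> tmonoid u -> commute s u.
Proof.
move=> sT; elim=> [|j v _ IH]; first exact: commute1.
by apply: commuteM IH; exact/commute_sym/tmonoid_commute_t.
Qed.

Lemma tmonoid_aJ s : tmonoid s -> exists m, a ^ s^-1 = a ^+ m.
Proof.
elim=> [|i u uT [m am]]; first by exists 1%N; rewrite invg1 conjg1 expg1.
exists (n i * m)%N; rewrite invgM conjgM am conjXg gamma_aJ.
by rewrite expgnA.
Qed.

(** Conjugating by the product of the two denominators turns both generators
    into powers of [a]. *)
Lemma akernel_gen_commute s u : tmonoid s -> tmonoid u ->
  commute (a ^ s) (a ^ u).
Proof.
move=> sT uT; apply: (@conjg_inj _ (s^-1 * u^-1)); rewrite [LHS]conjMg [RHS]conjMg.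
have [k ek] := tmonoid_aJ sT; have [m em] := tmonoid_aJ uT.
have -> : (a ^ s) ^ (s^-1 * u^-1) = a ^+ m by rewrite conjgM conjgK em.
have -> : (a ^ u) ^ (s^-1 * u^-1) = a ^+ k.
  by rewrite -invgM -(tmonoid_commute sT uT) invgM conjgM conjgK ek.
exact: commuteX2.
Qed.

Lemma akernel_commute g h : akernel g -> akernel h -> commute g h.
Proof.
move=> gA; elim=> [u uT|h1 h2 _ c1 _ c2]; last first.
  by apply: commuteM => //; exact: commuteV.
elim: gA => [s sT|g1 g2 _ c1 _ c2]; first exact: akernel_gen_commute.
by apply/commute_sym/commuteM; [|apply: commuteV]; exact: commute_sym.
Qed.

Lemma akernel1 : akernel 1.
Proof.
have := akernel_gen tmonoid1; rewrite conjg1 => aA.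
by rewrite -(mulgV a); exact: akernel_div.
Qed.

Lemma akernelV g : akernel g -> akernel g^-1.
Proof. by rewrite -div1g; apply: akernel_div; exact: akernel1. Qed.

Lemma akernelM g h : akernel g -> akernel h -> akernel (g * h).
Proof. by move=> gA /akernelV hA; rewrite -[h]invgK; exact: akernel_div. Qed.

Lemma akernelX g k : akernel g -> akernel (g ^+ k).
Proof.
move=> gA; elim: k => [|k IH]; first exact: akernel1.
by rewrite expgS; exact: akernelM.
Qed.

(** Conjugation by [t i] is the [n i]-th power map on the whole kernel, not only
    on [a]: power maps are multiplicative because the kernel is abelian. *)
Lemma akernel_t i g : akernel g -> g ^ (t i)^-1 = g ^+ n i.
Proof.
elim=> [s sT|x y xA ex yA ey].
  rewrite -conjgM (_ : s * (t i)^-1 = (t i)^-1 * s); last first.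
    by apply/commuteV/commute_sym/tmonoid_commute_t.
  by rewrite conjgM gamma_aJ conjXg.
rewrite conjMg conjVg ex ey expgMn ?expVgn//.
by apply: commuteV; exact: akernel_commute.
Qed.

Lemma akernel_tX i k g : akernel g -> g ^ (t i ^- k) = g ^+ (n i ^ k).
Proof.
move=> gA; elim: k => [|k IH]; first by rewrite expg0 invg1 conjg1 expg1.
rewrite expgSr invgM conjgM akernel_t // conjXg IH -expgnA.
by rewrite mulnC expnS mulnC.
Qed.

Lemma akernelJ g h : akernel g -> akernel (g ^ h).
Proof.
move=> gA; suff [] : (forall g, akernel g -> akernel (g ^ h)) /\
    (forall g, akernel g -> akernel (g ^ h^-1)) by move=> + _; exact.
pattern h; apply: (generates_ind (@gamma_generates r n)) => {g gA}.
- by split=> g; rewrite ?invg1 conjg1.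
- move=> x y [x1 x2] [y1 y2]; split=> g gA.
    by rewrite conjgM; exact/y2/x1.
  by rewrite invgM invgK conjgM; exact/x2/y1.
- move=> x [->|[i ->]]; split=> g gA.
  + suff -> : g ^ a = g by [].
    apply/eqP; rewrite conjg_fix; apply/commgP/akernel_commute => //.
    by rewrite -[a]conjg1; exact/akernel_gen/tmonoid1.
  + suff -> : g ^ a^-1 = g by [].
    apply/eqP; rewrite conjg_fix; apply/commgP/commuteV/akernel_commute => //.
    by rewrite -[a]conjg1; exact/akernel_gen/tmonoid1.
  + elim: gA => [s sT|u v _ IHu _ IHv].
      rewrite -conjgM -(tmonoid_commute_t i sT).
      exact/akernel_gen/tmonoidM.
    by rewrite conjMg conjVg; exact: akernel_div.
  + by rewrite akernel_t //; exact: akernelX.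
Qed.

(** The kernel is normal and contains the commutators of the generators, so it
    suffices to pass from generators to arbitrary elements in each argument. *)
Lemma akernel_commg g h : akernel [~ g, h].
Proof.
pose gens := [set g | g = a \/ exists i, g = t i].
have commg_gens (x : gamma n) : (forall y, gens y -> akernel [~ x, y]) ->
    forall y, akernel [~ x, y].
  move=> xA y; pattern y; apply: (generates_ind (@gamma_generates r n));
    last exact: xA.
    by rewrite commg1; exact: akernel1.
  move=> u v xu xv; rewrite (_ : [~ x, _] = ([~ x, v]^-1 * [~ x, u]) ^ v^-1).
    exact/akernelJ/akernelM/xu/akernelV/xv.
  by rewrite /commg /conjg !gnorm.
have commg_sym x y : akernel [~ x, y] -> akernel [~ y, x].
  by move=> /akernelV; rewrite invgR.
apply: (commg_gens) => y yG; apply: (commg_sym); apply: commg_gens => x xG.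
have aA u : gens u -> akernel [~ a, u].
  move=> uG; rewrite commgEl; apply: akernelM.
    by apply: akernelV; rewrite -[a]conjg1; exact/akernel_gen/tmonoid1.
  by apply: akernelJ; rewrite -[a]conjg1; exact/akernel_gen/tmonoid1.
case: yG => [->|[i ei]]; first exact: aA.
case: xG => [->|[j ->]]; first by apply/commg_sym/aA; right; exists i.
rewrite ei (_ : [~ _, _] = 1); first exact: akernel1.
exact/eqP/commgP/gamma_tC.
Qed.

End Kernel.

(** * Characters with connected half-space *)

Section Connected.
Variables (R : realType) (r : nat) (n : 'I_r -> nat).
Variables (X : set (gamma n)) (chi : nzchar R (gamma n)).
Hypotheses (genX : generates X) (n_large : exists i, (1 < n i)%N).
Local Notation t := (gamma_t n).

Lemma akernel_char g : akernel g -> chi g = 0.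
Proof.
have [i ni] := n_large.
elim=> [s _|x y _ ex _ ey]; first by rewrite nzcharJ (char_gamma_a _ ni).
by rewrite nzcharM nzcharV ex ey subr0.
Qed.

Lemma akernel_connected :
  (forall g, akernel g -> reachable X chi g) -> cayley_ge0_connected X chi.
Proof. exact: connected_of_kernel genX _ (@akernel_commg _ n). Qed.

Lemma reachable_power i g : 0 < chi (t i) -> akernel g ->
  exists M, reachable X chi (g ^+ (n i ^ M))%g.
Proof.
move=> ci gA.
have [M] := reachable_contract genX (@akernel_commg _ n)
  (@akernel_commute _ n) akernel_char gA ci.
by rewrite akernel_tX //; exists M.
Qed.

(** Here [(t j)^-1] extracts roots in the kernel: a high enough root of [g] is
    reachable, and [g] is a power of it. *)
Lemma connected_neg j : chi (t j) < 0 -> cayley_ge0_connected X chi.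
Proof.
move=> cj; apply: akernel_connected => g gA.
have [|M] := reachable_contract genX (@akernel_commg _ n)
  (@akernel_commute _ n) akernel_char (u := (t j)^-1%g) gA.
  by rewrite nzcharV oppr_gt0.
rewrite expVgn invgK => gM.
rewrite -[g](conjgK (t j ^+ M)%g) akernel_tX; last exact: akernelJ.
exact: reachableX.
Qed.

(** Both [t j] and [t k] contract, which makes two coprime powers of [g]
    reachable; [g] is then recovered by a Bezout relation. *)
Lemma connected_coprime j k : coprime (n j) (n k) -> 0 < chi (t j) ->
  0 < chi (t k) -> cayley_ge0_connected X chi.
Proof.
move=> cjk cj ck; apply: akernel_connected => g gA.
have [M gM] := reachable_power cj gA; have [K gK] := reachable_power ck gA.
have cMK : coprime (n j ^ M) (n k ^ K) by rewrite coprimeXl ?coprimeXr.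
(* If [n j ^ M] is 0, coprimality forces the other exponent to be 1. *)
have [nj0|nj0] := posnP (n j ^ M).
  by move: cMK gK; rewrite nj0 /coprime gcd0n => /eqP ->; rewrite expg1.
have [u v e _] := egcdnP (n k ^ K) nj0; rewrite (eqP cMK) in e.
have -> : g = ((g ^+ (n j ^ M)) ^+ u * ((g ^+ (n k ^ K)) ^+ v)^-1)%g.
  apply: (@mulIg _ ((g ^+ (n k ^ K)) ^+ v)%g); rewrite mulgVK -!expgnA.
  by rewrite [(_ * u)%N]mulnC [(_ * v)%N]mulnC e addnC expgnDr expg1.
apply: reachableM; first exact: reachableX.
apply: reachableV; last exact: reachableX.
by rewrite !nzcharX (akernel_char gA) !mul0rn.
Qed.

Lemma connected_trivial j : n j = 1%N -> 0 < chi (t j) ->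
  cayley_ge0_connected X chi.
Proof.
move=> nj cj; apply: akernel_connected => g gA.
by have [M] := reachable_power cj gA; rewrite nj exp1n expg1.
Qed.

Lemma disconnected_axis :
  (forall i, 0 < n i)%N -> (forall i j, i != j -> coprime (n i) (n j)) ->
  ~ cayley_ge0_connected X chi ->
  exists i, [/\ (1 < n i)%N, 0 < chi (t i) &
    forall j, j != i -> chi (t j) = 0].
Proof.
move=> npos ncop ncon.
have c_ge0 j : 0 <= chi (t j).
  by rewrite leNgt; apply/negP => /connected_neg.
have [i ci] : exists i, 0 < chi (t i).
  apply: contrapT => Hn; have [g /eqP] := nzchar_neq0 chi; apply.
  have [j nj] := n_large.
  pattern g; apply: (generates_ind (@gamma_generates r n)).
  - exact: nzchar1.
  - by move=> h k; rewrite nzcharM nzcharV => -> ->; rewrite subr0.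
  - move=> x [->|[i ->]]; first exact: char_gamma_a nj.
    apply/eqP; rewrite eq_le c_ge0 andbT leNgt; apply/negP => ci.
    by apply: Hn; exists i.
exists i; split=> // [|j ji].
  by rewrite ltn_neqAle npos andbT; apply/eqP => /esym /connected_trivial/(_ ci).
apply/eqP; rewrite eq_le c_ge0 andbT leNgt; apply/negP => cj.
exact/ncon/(connected_coprime (ncop _ _ ji)).
Qed.

End Connected.

(** * Rational numbers integral at a prime *)

Section LocalIntegers.
Variable p : nat.
Implicit Types x y : rat.

(** Membership in the localization of the integers at [p]. *)
Definition pint x := exists2 d : nat, coprime p d & x * d%:R \is a Num.int.

Lemma pint_nat m : pint m%:R.
Proof. by exists 1%N; rewrite ?coprimen1// mulr1 natr_int. Qed.

Lemma pintD x y : pint x -> pint y -> pint (x + y).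
Proof.
move=> [d pd xd] [e pe ye]; exists (d * e)%N; first by rewrite coprimeMr pd.
rewrite natrM mulrDl mulrA [y * _]mulrCA rpredD//.
  by rewrite rpredM // natr_int.
by rewrite rpredM // natr_int.
Qed.

Lemma pintM x y : pint x -> pint y -> pint (x * y).
Proof.
move=> [d pd xd] [e pe ye]; exists (d * e)%N; first by rewrite coprimeMr pd.
by rewrite natrM mulrACA rpredM.
Qed.

Lemma pint_natV m : coprime p m -> (0 < m)%N -> pint m%:R^-1.
Proof. by move=> pm m0; exists m; rewrite // mulVf// pnatr_eq0 -lt0n. Qed.

Lemma pint_natX m (e : int) : 0 <= e -> pint (m%:R ^ e).
Proof. by case: e => // k _; rewrite -exprnP -natrX; exact: pint_nat. Qed.

Lemma pint_clear N x : prime p -> (p %| N)%N -> exists K, pint (N%:R ^+ K * x).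
Proof.
move=> pp /dvdnP[m ->].
have d0 : (0 < `|denq x|)%N by rewrite absz_gt0 denq_neq0.
have [d pd e] := pfactor_coprime pp d0.
exists (logn p `|denq x|); rewrite natrM exprMn -mulrA -natrX.
apply: pintM; first exact: pint_nat.
exists d => //.
have -> : p%:R ^+ logn p `|denq x| * x * d%:R = (numq x)%:~R :> rat; last first.
  exact: intr_int.
rewrite mulrAC -natrX -natrM mulnC -e mulrC.
have -> : `|denq x|%:R = (denq x)%:~R :> rat.
  by rewrite -[in RHS]absz_denq.
by rewrite numqE.
Qed.

Lemma pint_mono N K L x : (K <= L)%N -> pint (N%:R ^+ K * x) ->
  pint (N%:R ^+ L * x).
Proof.
move=> KL xK; rewrite -(subnK KL) exprD -mulrA; apply: pintM => //.
by rewrite -natrX; exact: pint_nat.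
Qed.

Lemma not_pint_natV N : prime p -> (p %| N)%N -> (0 < N)%N -> ~ pint N%:R^-1.
Proof.
move=> pp pN N0 [d pd /intrP[z e]].
have eN : d%:Z = z * N%:Z.
  apply: (@intr_inj rat); rewrite intrM -e mulrAC mulVf ?mul1r//.
  by rewrite pnatr_eq0 -lt0n.
have : (p %| d)%N.
  by have := congr1 absz eN; rewrite abszM /= => ->; exact: dvdn_mull.
by move: pd; rewrite prime_coprime // => /negbTE ->.
Qed.

End LocalIntegers.

(** * The affine action on the rationals *)

Section Affine.
Variables (R : realType) (r : nat) (n : 'I_r -> nat).
Hypothesis npos : forall i, (0 < n i)%N.

Definition aff_letter (l : option 'I_r * bool) (z : rat) : rat :=
  match l with
  | (None, b) => if b then z - 1 else z + 1
  | (Some i, b) => if b then (n i)%:R^-1 * z else (n i)%:R * z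
  end.

Definition aff_word (w : word (option 'I_r)) (z : rat) : rat :=
  foldr aff_letter z w.

Let n_neq0 i : (n i)%:R != 0 :> rat.
Proof. by rewrite pnatr_eq0 -lt0n. Qed.

Lemma aff_word_cat u v z : aff_word (u ++ v) z = aff_word u (aff_word v z).
Proof. exact: foldr_cat. Qed.

Lemma aff_word_pres u v : pres_eq (gamma_rel n) u v -> aff_word u =1 aff_word v.
Proof.
elim=> {u v} //.
- by move=> u v _ e z; rewrite e.
- by move=> u v w _ e _ f z; rewrite e f.
- by move=> u u' v v' _ e _ f z; rewrite !aff_word_cat e f.
- by move=> [i|] [] z /=; rewrite ?mulKf ?mulVKf ?addrK ?subrK.
- move=> u v [i j _|i] z /=; first by rewrite mulrCA.
  rewrite mulrDr mulr1 mulVKf //.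
  by elim: (n i) => [|k IH] /=; rewrite ?addr0 // -IH -natr1 addrA.
Qed.

Definition aff (g : gamma n) : rat -> rat := aff_word (repr g).

Lemma aff_class w z : aff (pclass (gamma_rel n) w) z = aff_word w z.
Proof. exact/aff_word_pres/pres_repr. Qed.

Lemma affM g h z : aff (g * h)%g z = aff g (aff h z).
Proof. by rewrite -[RHS]aff_word_cat -aff_class. Qed.

Lemma aff1 z : aff 1%g z = z.
Proof. exact: aff_class. Qed.

Lemma affVK g z : aff g^-1%g (aff g z) = z.
Proof. by rewrite -affM mulVg aff1. Qed.

Lemma aff_t i z : aff (gamma_t n i) z = (n i)%:R * z.
Proof. exact: aff_class. Qed.

Lemma aff_a z : aff (gamma_a n) z = z + 1.
Proof. exact: aff_class. Qed.

Lemma aff_tX i k z : aff (gamma_t n i ^+ k)%g z = (n i)%:R ^+ k * z.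
Proof.
elim: k => [|k IH]; first by rewrite expg0 aff1 expr0 mul1r.
by rewrite expgS affM IH aff_t mulrA exprS.
Qed.

Lemma aff_aJ i k : aff (gamma_a n ^ (gamma_t n i ^+ k))%g 0 = (n i)%:R ^- k.
Proof.
rewrite /conjg !affM aff_tX mulr0 aff_a add0r.
rewrite -[RHS](affVK (gamma_t n i ^+ k)%g) aff_tX mulfV//.
by rewrite expf_neq0.
Qed.

Section LocalSlope.
Variables (p : nat) (j : 'I_r).
Hypothesis p_prime : prime p.
Hypothesis p_nj : (p %| n j)%N.
Hypothesis p_ni : forall i, i != j -> coprime p (n i).
Local Notation N := ((n j)%:R : rat).

(** The slope of an element is [n j] to the power of its [t j]-exponent, up to
    a factor that is integral at [p]. *)
Lemma aff_slope g : exists2 e : int, e%:~R = tchar R n j g &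
  exists2 q, pint p q & forall z, aff g z = aff g 0 + N ^ e * q * z.
Proof.
rewrite /= /tchar_fun /aff; elim: (repr g) => [|[x b] w [e ee [q pq qE]]].
  exists 0; first by rewrite /texp big_nil.
  exists 1; first exact: (pint_nat p 1).
  by move=> z; rewrite /= expr0z add0r !mul1r.
case: x => [i|]; last first.
  exists e; first by rewrite /texp big_cons.
  by exists q => // z; case: b; rewrite /= qE; ring.
have [->|ij] := eqVneq i j.
  exists (e + (if b then -1 else 1)).
    rewrite rmorphD /= ee /texp big_cons /= eqxx addrC.
    by case: b.
  exists q => // z; rewrite /= expfzDr // qE; case: b; rewrite ?exprN1 ?expr1z; ring.
exists e.
  by rewrite ee /texp big_cons /= -[Some i == _]/(i == j) (negbTE ij).
exists ((if b then (n i)%:R^-1 else (n i)%:R) * q).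
  by apply: pintM => //; case: b; [apply: pint_natV => //; exact: p_ni|exact: pint_nat].
by move=> z; case: b; rewrite /= qE; ring.
Qed.

Lemma pint_clear_finite (X : set (gamma n)) : finite_set X ->
  exists K, forall y, X y \/ X y^-1%g -> pint p (N ^+ K * aff y 0).
Proof.
move=> /finite_seqP[s ->].
elim: s => [|x s [K HK]]; first by exists 0%N => y [].
have [K1 H1] := pint_clear (aff x 0) p_prime p_nj.
have [K2 H2] := pint_clear (aff x^-1%g 0) p_prime p_nj.
exists (maxn K (maxn K1 K2)) => y.
have mono L z : (L <= maxn K (maxn K1 K2))%N -> pint p (N ^+ L * z) ->
  pint p (N ^+ maxn K (maxn K1 K2) * z) by exact: pint_mono.
rewrite /= !inE => -[] /orP[/eqP e|ys].
- by rewrite e; apply: mono H1; rewrite !leq_max leqnn orbT.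
- by apply: (mono K); [rewrite leq_max leqnn|apply: HK; left].
- have -> : y = x^-1%g by rewrite -e invgK.
  by apply: mono H2; rewrite !leq_max leqnn !orbT.
- by apply: (mono K); [rewrite leq_max leqnn|apply: HK; right].
Qed.

(** The slopes along a path in the half-space are integral at [p], so the
    translation parts never acquire more powers of [p] in the denominator than
    the generators have. *)
Lemma reach_pint (X : set (gamma n)) (chi : nzchar R (gamma n)) K g h :
  (forall g, 0 <= chi g -> 0 <= tchar R n j g) ->
  (forall y, X y \/ X y^-1%g -> pint p (N ^+ K * aff y 0)) ->
  reach X chi g h -> pint p (N ^+ K * aff g 0) -> pint p (N ^+ K * aff h 0).
Proof.
move=> chi_t HK [s]; elim: s g => [|k s IH] g /=; first by move=> _ ->.
move=> /andP[/and3P[g0 _ /asboolP[y Xy ky]] ps] sh gK.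
apply: (IH _ ps sh); rewrite ky affM.
have [e ee [q pq ->]] := aff_slope g.
rewrite mulrDr; apply: pintD => //.
rewrite mulrCA; apply: pintM; last exact: HK.
by apply: pintM => //; apply: pint_natX; rewrite -(ler0z R) ee chi_t.
Qed.

Lemma axis_disconnected (X : set (gamma n)) (chi : nzchar R (gamma n)) :
  finite_set X -> (forall g, 0 <= chi g -> 0 <= tchar R n j g) ->
  chi (gamma_a n) = 0 -> ~ cayley_ge0_connected X chi.
Proof.
move=> finX chi_t chi_a conn.
have [K HK] := pint_clear_finite finX.
(* The translation part of this element has exponent one more than the bound
   [K] on the denominators of the generators. *)
have [|| s ps sl] := conn 1%g (gamma_a n ^ (gamma_t n j ^+ K.+1))%g.
- by rewrite nzchar1.
- by rewrite nzcharJ chi_a.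
have := reach_pint chi_t HK (ex_intro2 _ _ s ps sl).
rewrite aff1 mulr0 aff_aJ exprS invfM mulrCA mulfV ?expf_neq0// mulr1.
move=> /(_ (pint_nat p 0)).
exact: not_pint_natV (npos j).
Qed.

End LocalSlope.
End Affine.

(** * The complement of the invariant *)

Section Complement.
Variables (R : realType) (r : nat) (n : 'I_r -> nat).
Hypothesis npos : forall i, (0 < n i)%N.
Hypothesis ncop : forall i j, i != j -> coprime (n i) (n j).
Hypothesis n_large : exists i, (1 < n i)%N.
Local Notation t := (gamma_t n).

(** Both sides vanish on [a], so they are compared on the [t j] only. *)
Lemma char_class_axis (chi : nzchar R (gamma n)) i : 0 < chi (t i) ->
  (forall j, j != i -> chi (t j) = 0) ->
  char_class chi = char_class (tchar R n i).
Proof.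
move=> ci c0; have [k nk] := n_large.
apply/esym/char_classP; exists (chi (t i)) => // g.
pattern g; apply: (generates_ind (@gamma_generates r n)).
- by rewrite !nzchar1 mulr0.
- by move=> x y ex ey; rewrite !nzcharM !nzcharV mulrDr mulrN ex ey.
- move=> x [->|[j ->]]; first by rewrite !(char_gamma_a _ nk) mulr0.
  rewrite tchar_t; have [->|/c0 ->] := eqVneq j i; first by rewrite mulr1.
  by rewrite mulr0.
Qed.

Lemma Sigma1_complement (X : set (gamma n)) : finite_set X -> generates X ->
  ~` Sigma1 (R := R) X
    = [set char_class (tchar R n i) | i in [set i | (1 < n i)%N]].
Proof.
move=> finX genX; apply/seteqP; split=> [c nc|_ [i ni <-] [chi conn e]].
  have ec : char_class (repr c) = c by rewrite /char_class reprK.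
  have [|i [ni ci c0]] := disconnected_axis (chi := repr c) genX n_large npos ncop.
    by move=> conn; apply: nc; exists (repr c).
  by exists i => //; rewrite -(char_class_axis ci c0).
have [s s0 es] := (char_classP _ _).1 e.
have [p pp pn] : exists2 p, prime p & (p %| n i)%N.
  by exists (pdiv (n i)); [exact: pdiv_prime|exact: pdiv_dvd].
apply: (axis_disconnected npos pp pn _ finX _ _ conn).
- by move=> k ki; apply: coprime_dvdl pn (ncop _); rewrite eq_sym.
- by move=> g g0; rewrite -es mulr_ge0// ltW.
- exact: char_gamma_a ni.
Qed.

Lemma enorm_delta (i : 'I_r) : enorm (delta_mx 0 i : 'rV[R]_r) = 1.
Proof.
rewrite /enorm /dotrv (bigD1 i) //= big1 => [|k ki].
  by rewrite !mxE !eqxx mulr1 addr0 sqrtr1.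
by rewrite !mxE (negbTE ki) andbF mulr0.
Qed.

Lemma sphere_coord_tchar i :
  sphere_coord t (char_class (tchar R n i)) = delta_mx 0 i.
Proof.
rewrite sphere_coord_class /char_coord.
have -> : \row_k tchar R n i (t k) = delta_mx 0 i :> 'rV[R]_r.
  by apply/rowP => k; rewrite !mxE tchar_t eqxx.
by rewrite enorm_delta invr1 scale1r.
Qed.

(** The hemisphere around the diagonal direction contains all coordinate
    directions. *)
Lemma axes_in_hemisphere : exists2 H : set (char_sphere R (gamma n)),
  open_hemisphere t H & forall i, H (char_class (tchar R n i)).
Proof.
have r0 : 0 < r%:R :> R.
  by have [i _] := n_large; rewrite ltr0n; case: r i => [[]|].
pose v : 'rV[R]_r := const_mx (Num.sqrt r%:R)^-1.
exists [set c | 0 < dotrv (sphere_coord t c) v].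
  exists v => //; rewrite /enorm /dotrv.
  under eq_bigr do rewrite !mxE -expr2.
  rewrite sumr_const card_ord exprVn sqr_sqrtr ?ltW//.
  by rewrite -[_^-1 *+ r]mulr_natl mulfV ?gt_eqF// sqrtr1.
move=> i /=; rewrite sphere_coord_tchar /dotrv (bigD1 i) //= big1 => [|k ki].
  by rewrite !mxE !eqxx mul1r addr0 invr_gt0 sqrtr_gt0.
by rewrite !mxE (negbTE ki) andbF mul0r.
Qed.

End Complement.

Theorem theorem2p4 (R : realType) :
  (forall (r : nat) (n : 'I_r -> nat),
     injective n ->
     (forall i, 0 < n i)%N ->
     (forall i j, i != j -> coprime (n i) (n j)) ->
     (exists i, 1 < n i)%N ->
     forall X : set (gamma n), finite_set X -> generates X ->
     [/\ ~` Sigma1 (R := R) X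
           = [set char_class (tchar R n i) | i in [set i | (1 < n i)%N]],
         (forall i, 1 < n i)%N ->
           ~` Sigma1 (R := R) X = [set char_class (tchar R n i) | i in setT]
       & exists2 H : set (char_sphere R (gamma n)),
           open_hemisphere (gamma_t n) H & ~` Sigma1 (R := R) X `<=` H])
  /\
  (forall (m r : nat) (p y : 'I_r -> nat),
     (1 < m)%N ->
     injective p ->
     (forall i, prime (p i)) ->
     (forall i, 0 < y i)%N ->
     m = (\prod_(i < r) p i ^ y i)%N ->
     let n := fun i => (p i ^ y i)%N in
     forall X : set (gamma n), finite_set X -> generates X ->
     ~` Sigma1 (R := R) X = [set char_class (tchar R n i) | i in setT]).
Proof.
have main (r : nat) (n : 'I_r -> nat) :
    (forall i, 0 < n i)%N ->
    (forall i j, i != j -> coprime (n i) (n j)) ->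
    (forall i, 1 < n i)%N -> (exists i, 1 < n i)%N ->
    forall X : set (gamma n), finite_set X -> generates X ->
    ~` Sigma1 (R := R) X = [set char_class (tchar R n i) | i in setT].
  move=> npos ncop n1 n_large X finX genX.
  rewrite Sigma1_complement //; congr image.
  by apply/seteqP; split=> i _ //=; exact: n1.
split=> [r n ninj npos ncop n_large X finX genX|].
  split; first exact: Sigma1_complement.
    by move=> n1; exact: main.
  have [H Hh HH] := axes_in_hemisphere R n_large.
  by exists H => //; rewrite Sigma1_complement // => _ [i _ <-].
move=> m r p y m1 pinj pp y0 em n X finX genX.
have n1 i : (1 < n i)%N.
  by rewrite -(exp1n (y i)) ltn_exp2r // prime_gt1.
apply: main => // [i|i j ij|]; first exact: ltnW.
  rewrite coprimeXl ?coprimeXr // prime_coprime // dvdn_prime2 //.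
  by rewrite (inj_eq pinj).
case: r p y pinj pp y0 em n X finX genX n1 => [|r] p y _ _ _ em n _ _ _ n1.
  by rewrite em big_ord0 in m1.
by exists ord0.
Qed.
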